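(* Let $(\theta_n)_{n\ge 0}$ be generated by the MLMC-adaptive stochastic gradient recursion $\theta_{n+1}=\theta_n-\gamma_{n+1}A_n\widehat H^{(n+1)}$ described in the context, with step sizes $\gamma_n>0$ and truncation levels $T_n>0$. Assume: (i) $V:\mathbb{R}^d\to\mathbb{R}$ is differentiable and $\|\nabla V(\theta)-\nabla V(\theta')\|\le L\|\theta-\theta'\|$ for all $\theta,\theta'\in\mathbb{R}^d$; (ii) there is $G>0$ such that $\|H_\theta\|_\infty\le G$ for all $\theta\in\mathbb{R}^d$; (iii) there are constants $c_1,c_2$ such that for all $n\ge 0$, $$\left\|\mathbb{E}[\widehat H^{(n+1)}\mid\mathcal F_n]-h(\theta_n)\right\|\le \frac{c_1G}{T_{n+1}},\qquad \mathbb{E}\left[\|\widehat H^{(n+1)}\|^2\right]\le c_2G^2\log(T_{n+1});$$ (iv) for all $n\ge 0$ the matrix $A_n$ is $\mathcal F_n$-measurable and symmetric positive definite, and there are deterministic constants $0<\underline\lambda_{n+1}\le\overline\lambda_{n+1}$ with $\underline\lambda_{n+1}\le\lambda_{\min}(A_n)\le\lambda_{\max}(A_n)\le\overline\lambda_{n+1}$. For $N\ge 1$ put $\varpi_N=\sum_{k=0}^N\gamma_{k+1}\underline\lambda_{k+1}$ and let $R$ be a random variable, independent of the algorithm, with $\mathbb{P}[R=n]=\gamma_{n+1}\underline\lambda_{n+1}/\varpi_N$ for $n\in\{0,\dots,N\}$. Then for every $N\ge 1$, $$\mathbb{E}\left[\|\nabla V(\theta_R)\|^2\right]\le\frac{2}{\varpi_N}\left\{\mathbb{E}[V(\theta_0)]-V(\theta^*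 )+c_1G^2\sum_{n=1}^{N+1}\gamma_n\frac{\overline\lambda_n}{T_n}+c_2G^2\frac L2\sum_{n=1}^{N+1}\gamma_n^2\overline\lambda_n^2\log(T_n)\right\}.$$
   Context: Setting. $\|\cdot\|$ is the Euclidean norm on $\mathbb{R}^d$. $\theta^*\in\mathbb{R}^d$ is a global minimizer of $V$. For each $\theta\in\mathbb{R}^d$, $H_\theta:\mathbb{X}\to\mathbb{R}^d$ is a measurable function on a measurable space $\mathbb{X}\subseteq\mathbb{R}^q$, $\|H_\theta\|_\infty=\sup_{x\in\mathbb{X}}\|H_\theta(x)\|$, $P_\theta$ is a Markov kernel on $\mathbb{X}$ with invariant probability $\pi_\theta$, and $h(\theta)=\mathbb{E}_{\pi_\theta}[H_\theta(X)]$. Throughout it is assumed that $h(\theta)=\nabla V(\theta)$ for all $\theta$. MLMC estimator. $(K_n)_{n\ge1}$ are i.i.d. geometric, $\mathbb{P}(K_n=k)=2^{-k}$ for $k\ge1$. $\mathcal F_0$ is trivial and $\mathcal F_n=\sigma(K_1,\mathbf X^{(1)},\dots,K_n,\mathbf X^{(n)})$. At step $n\ge0$, given $\mathcal F_n$, $\mathbf X^{(n+1)}=(X_i^{(n+1)})_{i\ge1}$ is a Markov chain with kernel $P_{\theta_n}$, and $K_{n+1}$ is independent of $\mathcal F_n$ and $\mathbf X^{(n+1)}$. For an integer $p\ge1$ let $H_\theta^{(p)}(\mathbf x)=\frac1p\sum_{i=1}^pH_\theta(x_i)$. With $t_{n+1}=2^{K_{n+1}}$, the MLMC estimator is $$\widehat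 H^{(n+1)}=H_{\theta_n}(X_1^{(n+1)})+t_{n+1}\left\{H_{\theta_n}^{(t_{n+1})}(\mathbf X^{(n+1)})-H_{\theta_n}^{(t_{n+1}/2)}(\mathbf X^{(n+1)})\right\}\mathbf 1_{t_{n+1}\le T_{n+1}}.$$ Recursion. $\theta_0\in\mathbb{R}^d$ and $\theta_{n+1}=\theta_n-\gamma_{n+1}A_n\widehat H^{(n+1)}$ for $n\ge0$, with $(\gamma_n)_{n\ge1}$, $(T_n)_{n\ge1}$ positive deterministic sequences and $A_n$ a $d\times d$ preconditioning matrix. *)

(* Defs.v *)
From HB Require Import structures.
From mathcomp Require Export all_boot all_order all_algebra.
From mathcomp Require Export all_classical all_reals all_analysis.
Import Order.TTheory GRing.Theory Num.Theory.
Import numFieldNormedType.Exports.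

Set Implicit Arguments.
Unset Strict Implicit.
Unset Printing Implicit Defensive.

Local Open Scope classical_set_scope.
Local Open Scope ring_scope.

Section Euclidean.
Context {R : realType} {d : nat}.

(* The library norm on matrices is the sup norm; it induces the same topology,
   hence the same notion of differentiability. *)
Definition enorm (v : 'cV[R]_d) : R := Num.sqrt (\sum_(i < d) v i 0 ^+ 2).

Definition grad (V : 'cV[R]_d -> R) (t : 'cV[R]_d) : 'cV[R]_d :=
  \col_(i < d) 'D_(delta_mx i 0) V t.

Definition sym_posdef (A : 'M[R]_d) : Prop :=
  A^T = A /\ forall v : 'cV[R]_d, v != 0 -> 0 < (v^T *m A *m v) 0 0.

(* Smallest and largest eigenvalue. For symmetric A and 0 < d the set is finite
   and nonempty, so that inf and sup are attained. *)
Definition lambda_min (A : 'M[R]_d) : R := inf [set a : R | eigenvalue A a].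
Definition lambda_max (A : 'M[R]_d) : R := sup [set a : R | eigenvalue A a].

(* An extended real, hence +oo (and not a junk value) when f is unbounded. *)
Definition sup_enorm {S : Type} (f : S -> 'cV[R]_d) : \bar R :=
  ereal_sup [set (enorm (f x))%:E | x in [set: S]].

End Euclidean.

Section SigmaAlgebras.
Context {dO : measure_display} {Omega : measurableType dO}.

(* The sigma-algebra generated by f. *)
Definition sigma_rv {d'} {S : measurableType d'} (f : Omega -> S) :
  set (set Omega) := preimage_set_system setT f measurable.

Definition measurable_wrt {d'} {S : measurableType d'} (G : set (set Omega))
  (f : Omega -> S) : Prop := sigma_rv f `<=` G.

(* Borel measurability of a matrix-valued map is measurability of entries. *)
Definition mx_measurable_wrt {R : realType} {m n : nat} (G : set (set Omega))
  (f : Omega -> 'M[R]_(m, n)) : Prop :=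
  forall i j, measurable_wrt G (fun w => f w i j : R).

End SigmaAlgebras.

(* S is, up to renaming of its points, a subset of R^q with the trace of the
   Borel sigma-algebra. *)
Definition is_subspace_of_Rn (R : realType) (q : nat) {d'}
  (S : measurableType d') : Prop :=
  exists iota : S -> 'cV[R]_q, injective iota /\
    (@measurable _ S =
     <<s \bigcup_(i in [set: 'I_q]) sigma_rv (fun x => iota x i 0 : R) >>).

Section Probability.
Context {R : realType} {dO : measure_display} {Omega : measurableType dO}.
Variable P : probability Omega R.

(* Y is a version of E[X | G]. *)
Definition is_cond_exp (G : set (set Omega)) (X Y : Omega -> R) : Prop :=
  [/\ P.-integrable setT (EFin \o X), P.-integrable setT (EFin \o Y),
      measurable_wrt G Y &
      forall A, G A ->
        (\int[P]_(w in A) (Y w)%:E = \int[P]_(w in A) (X w)%:E)%E].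

Definition is_cond_exp_vec {d : nat} (G : set (set Omega))
  (X Y : Omega -> 'cV[R]_d) : Prop :=
  forall i, is_cond_exp G (fun w => X w i 0) (fun w => Y w i 0).

Definition indep_of {d'} {S : measurableType d'} (Z : Omega -> S)
  (G : set (set Omega)) : Prop :=
  forall B A, measurable B -> G A ->
    (P (Z @^-1` B `&` A) = P (Z @^-1` B) * P A)%E.

Definition mutually_indep {d'} {S : measurableType d'} (Z : nat -> Omega -> S) :
  Prop :=
  forall (s : seq nat) (B : nat -> set S), uniq s ->
    (forall n, measurable (B n)) ->
    P (\bigcap_(n in [set` s]) (Z n @^-1` B n)) =
    (\prod_(n <- s) P (Z n @^-1` B n))%E.

(* (x_i)_{i >= 1} is, conditionally on G, a Markov chain whose transition
   kernel Q is random (and known given G); the law of x_1 is unconstrained. *)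
Definition markov_chain_given {d'} {S : measurableType d'}
  (G : set (set Omega)) (Q : Omega -> R.-pker S ~> S) (x : nat -> Omega -> S) :
  Prop :=
  forall (i : nat) (B : set S), (1 <= i)%N -> measurable B ->
    is_cond_exp
      <<s G `|` \bigcup_(j in [set j | (1 <= j <= i)%N]) sigma_rv (x j) >>
      (\1_(x i.+1 @^-1` B)) (fun w => fine (Q w (x i w) B)).

(* (K_n)_{n >= 1} i.i.d. with P(K_n = k) = 2^-k for k >= 1. *)
Definition iid_geometric_half (K : nat -> Omega -> nat) : Prop :=
  mutually_indep (fun n => K n.+1) /\
  forall n k : nat, (1 <= n)%N -> (1 <= k)%N ->
    P (K n @^-1` [set k]) = ((2^-1 : R) ^+ k)%:E.

End Probability.

Section MeanField.
Context {R : realType} {d : nat} {dS : measure_display} {S : measurableType dS}.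

Definition invariant_law (Q : R.-pker S ~> S) (mu : probability S R) : Prop :=
  forall B, measurable B -> (\int[mu]_x Q x B = mu B)%E.

Definition mean_field (H : 'cV[R]_d -> S -> 'cV[R]_d)
  (pi : 'cV[R]_d -> probability S R) (t : 'cV[R]_d) : 'cV[R]_d :=
  \col_(i < d) \int[pi t]_(x in setT) (H t x i 0).

End MeanField.

Section MLMC.
Context {R : realType} {d : nat} {dS : measure_display} {S : measurableType dS}.

(* Trajectories x = (x_i) are indexed from 1; x 0 is never used. *)
Definition traj_mean (H : S -> 'cV[R]_d) (p : nat) (x : nat -> S) : 'cV[R]_d :=
  p%:R^-1 *: \sum_(1 <= i < p.+1) H (x i).

Definition mlmc_estimator (H : S -> 'cV[R]_d) (T : R) (k : nat) (x : nat -> S) :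
  'cV[R]_d :=
  let t := (2 ^ k)%N in
  H (x 1%N) +
  (t%:R * (t%:R <= T :> R)%:R) *: (traj_mean H t x - traj_mean H (t %/ 2) x).

Context {dO : measure_display} {Omega : measurableType dO}.

(* sigma(K_1, X^(1), ..., K_n, X^(n)), trivial for n = 0. As for gamma, T, K and
   the trajectories, indices start at 1 and the terms of index 0 are unused. *)
Definition mlmc_filtration (K : nat -> Omega -> nat)
  (X : nat -> nat -> Omega -> S) (n : nat) : set (set Omega) :=
  <<s \bigcup_(m in [set m | (1 <= m <= n)%N])
        (sigma_rv (K m) `|`
         \bigcup_(i in [set i | (1 <= i)%N]) sigma_rv (X m i)) >>.

Definition mlmc_sigma (K : nat -> Omega -> nat) (X : nat -> nat -> Omega -> S) :
  set (set Omega) := <<s \bigcup_n mlmc_filtration K X n >>.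

(* mlmc_hatH n stands for \widehat H^{(n+1)}. *)
Definition mlmc_hatH (H : 'cV[R]_d -> S -> 'cV[R]_d) (T : nat -> R)
  (K : nat -> Omega -> nat) (X : nat -> nat -> Omega -> S)
  (theta : nat -> Omega -> 'cV[R]_d) (n : nat) (w : Omega) : 'cV[R]_d :=
  mlmc_estimator (H (theta n w)) (T n.+1) (K n.+1 w) (fun i => X n.+1 i w).

(* The sampling mechanism. The variable K_{n+1} is independent of F_n and
   X^{(n+1)} taken jointly. *)
Definition mlmc_sampling (P : probability Omega R)
  (Pk : 'cV[R]_d -> R.-pker S ~> S)
  (K : nat -> Omega -> nat) (X : nat -> nat -> Omega -> S)
  (theta : nat -> Omega -> 'cV[R]_d) : Prop :=
  iid_geometric_half P K /\
  forall n : nat,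
    markov_chain_given P (mlmc_filtration K X n)
      (fun w => Pk (theta n w)) (X n.+1) /\
    indep_of P (K n.+1)
      <<s mlmc_filtration K X n `|`
          \bigcup_(i in [set i | (1 <= i)%N]) sigma_rv (X n.+1 i) >>.

(* Adaptedness of theta is part of the recursion being well defined; it is
   automatic when (t, x) |-> H t x is jointly measurable and each A n is
   measurable with respect to F_n. *)
Definition mlmc_recursion (H : 'cV[R]_d -> S -> 'cV[R]_d) (gamma T : nat -> R)
  (A : nat -> Omega -> 'M[R]_d)
  (K : nat -> Omega -> nat) (X : nat -> nat -> Omega -> S)
  (theta0 : 'cV[R]_d) (theta : nat -> Omega -> 'cV[R]_d) : Prop :=
  [/\ forall w, theta 0%N w = theta0,
      forall n w, theta n.+1 w =
        theta n w - gamma n.+1 *: (A n w *m mlmc_hatH H T K X theta n w) &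
      forall n, mx_measurable_wrt (mlmc_filtration K X n) (theta n)].

End MLMC.

(* Main.v *)
Require Import Defs.
From mathcomp Require Import all_boot all_order all_algebra.
From mathcomp Require Import all_classical all_reals all_analysis.
From mathcomp Require Import measurable_realfun ring lra.
Import Order.TTheory GRing.Theory Num.Theory.
Import numFieldNormedType.Exports.
Local Open Scope classical_set_scope.
Local Open Scope ring_scope.

(** One step of the recursion decreases the objective in expectation. Since
    [grad V] is [L]-Lipschitz, [descent] gives, with [g] the estimator,
      [V (th - gam A g) <= V th - gam <grad V th, A g>
                           + (L / 2) gam^2 |A g|^2].
    The matrix [A] is symmetric with spectrum in [[lo, hi]], so the last term
    is at most [(L / 2) gam^2 hi^2 |g|^2], whose expectation the second moment
    hypothesis controls. In the middle term [<grad V th, A g>] is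
    [<A grad V th, g>], and the first vector is known given the past; hence [g]
    may be replaced by its conditional expectation, which is the gradient up to
    the bias. This leaves [lo |grad V th|^2] minus at most [hi G] times the
    bias ([expected_inner_product_ge], [expected_descent_step]).

    Summing over [n <= N] the values of [V] telescope, and as [V] is bounded
    below by its minimum, this bounds [sum_n gam_n lo_n E |grad V th_n|^2]. The
    random index weighs the iterates proportionally to [gam_n lo_n] and is
    independent of them ([expectation_random_index]), so its expectation is that
    sum divided by [varpi]. This proves the bound with [1 / varpi] in front of
    the braces; the quantity in braces is then nonnegative, and the factor [2]
    can be inserted.

    Integrability is never an issue: the truncation makes the estimator bounded
    ([enorm_mlmc_estimator_le]), so each iterate is a bounded random vector, and
    a function with Lipschitz gradient that is bounded below is bounded on
    balls ([bounded_on_ball]). Two facts carry the rest of the argument. The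
    extreme values of the Rayleigh quotient of a symmetric matrix are
    eigenvalues ([min_rayleigh_eigenvalue]), which turns bounds on eigenvalues
    into bounds on quadratic forms. A bounded factor that is measurable for the
    conditioning sigma-algebra can be moved inside the integrals that define a
    conditional expectation ([Rintegral_bounded_mul_eq0]); the same statement
    also gives the factorization for the independent index. *)

Set Implicit Arguments.
Unset Strict Implicit.

(** * Euclidean geometry and quadratic forms of symmetric matrices *)

Section Euclid.
Context {R : realType} {d : nat}.
Implicit Types (u v w : 'cV[R]_d) (B : 'M[R]_d).

Definition dotv u v : R := \sum_(i < d) u i 0 * v i 0.

Lemma dotvC u v : dotv u v = dotv v u.
Proof. by apply: eq_bigr => i _; rewrite mulrC. Qed.

Lemma dotvDr u v w : dotv u (v + w) = dotv u v + dotv u w.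
Proof. by rewrite -big_split; apply: eq_bigr => i _; rewrite mxE mulrDr. Qed.

Lemma dotvZr a u v : dotv u (a *: v) = a * dotv u v.
Proof. by rewrite /dotv mulr_sumr; apply: eq_bigr => i _; rewrite mxE mulrCA. Qed.

Lemma dotvNr u v : dotv u (- v) = - dotv u v.
Proof. by rewrite -scaleN1r dotvZr mulN1r. Qed.

Lemma dotvBr u v w : dotv u (v - w) = dotv u v - dotv u w.
Proof. by rewrite dotvDr dotvNr. Qed.

Lemma dotvDl u v w : dotv (v + w) u = dotv v u + dotv w u.
Proof. by rewrite !(dotvC _ u) dotvDr. Qed.

Lemma dotvZl a u v : dotv (a *: v) u = a * dotv v u.
Proof. by rewrite !(dotvC _ u) dotvZr. Qed.

Lemma dotvBl u v w : dotv (v - w) u = dotv v u - dotv w u.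
Proof. by rewrite !(dotvC _ u) dotvBr. Qed.

Lemma dotvv_ge0 v : 0 <= dotv v v.
Proof. by apply: sumr_ge0 => i _; rewrite -expr2 sqr_ge0. Qed.

Lemma sqr_coord_le_dotv v i : v i 0 ^+ 2 <= dotv v v.
Proof.
rewrite /dotv (bigD1 i)//= -expr2 lerDl.
by apply: sumr_ge0 => j _; rewrite -expr2 sqr_ge0.
Qed.

Lemma dotvv_eq0 v : dotv v v = 0 -> v = 0.
Proof.
move=> v0; apply/matrixP => i j; rewrite ord1 mxE; apply/eqP.
by rewrite -sqrf_eq0 eq_le sqr_ge0 andbT -v0 sqr_coord_le_dotv.
Qed.

Lemma enorm_sqr v : enorm v ^+ 2 = dotv v v.
Proof. by rewrite sqr_sqrtr// (_ : \sum_i _ = dotv v v) ?dotvv_ge0. Qed.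

Lemma enorm_ge0 v : 0 <= enorm v. Proof. exact: sqrtr_ge0. Qed.

Lemma coord_le_enorm v i : `|v i 0| <= enorm v.
Proof.
rewrite -(@ler_pXn2r _ 2)// ?nnegrE ?enorm_ge0//.
by rewrite enorm_sqr real_normK ?num_real// sqr_coord_le_dotv.
Qed.

Lemma dotv_mulmx_sym B u v : B^T = B -> dotv u (B *m v) = dotv (B *m u) v.
Proof.
move=> sB; rewrite /dotv.
under eq_bigr do rewrite mxE mulr_sumr.
under [RHS]eq_bigr do rewrite mxE mulr_suml.
rewrite exchange_big; apply: eq_bigr => i _; apply: eq_bigr => j _.
by rewrite -[in RHS]sB mxE; ring.
Qed.

(** Evaluate at the minimizer [- b / c]; when [c] vanishes the polynomial is
    affine, so that [b] must vanish as well. *)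
Lemma quadratic_ge0_discr (a b c : R) : 0 <= c ->
  (forall s, 0 <= a + 2 * s * b + s ^+ 2 * c) -> b ^+ 2 <= a * c.
Proof.
rewrite le_eqVlt => /predU1P[<-|c0] P.
  have [->|b0] := eqVneq b 0; first by rewrite expr0n/= mulr0.
  (* at this point the affine function [a + 2 s b] takes the value [-1] *)
  have := P (- (a + 1) / (2 * b)).
  rewrite (_ : _ + _ = -1); last by field.
  by rewrite ler0N1.
have := P (- b / c).
rewrite (_ : _ + _ = a - b ^+ 2 / c); last by field; exact: lt0r_neq0.
by rewrite subr_ge0 ler_pdivrMr.
Qed.

(** The form of [B] is nonnegative along the line [u + s v], a quadratic
    polynomial in [s]. *)
Lemma psd_cauchy_schwarz B u v : B^T = B ->
  (forall x, 0 <= dotv x (B *m x)) ->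
  dotv u (B *m v) ^+ 2 <= dotv u (B *m u) * dotv v (B *m v).
Proof.
move=> sB psdB; apply: quadratic_ge0_discr => // s.
have := psdB (u + s *: v).
rewrite mulmxDr -scalemxAr !(dotvDl, dotvDr, dotvZl, dotvZr).
by rewrite (dotvC v (B *m u)) -(dotv_mulmx_sym _ _ sB) => Q; lra.
Qed.

Lemma cauchy_schwarz u v : `|dotv u v| <= enorm u * enorm v.
Proof.
rewrite -(@ler_pXn2r _ 2)// ?nnegrE ?mulr_ge0 ?enorm_ge0//.
rewrite real_normK ?num_real// exprMn !enorm_sqr.
have := @psd_cauchy_schwarz 1%:M u v; rewrite !mul1mx; apply.
  by rewrite trmx1.
by move=> x; rewrite mul1mx dotvv_ge0.
Qed.

Lemma dotv_le_enorm u v : dotv u v <= enorm u * enorm v.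
Proof. exact: le_trans (ler_norm _) (cauchy_schwarz u v). Qed.

Lemma enormD u v : enorm (u + v) <= enorm u + enorm v.
Proof.
rewrite -(@ler_pXn2r _ 2)// ?nnegrE ?addr_ge0 ?enorm_ge0//.
rewrite sqrrD !enorm_sqr dotvDl !dotvDr (dotvC v u).
have := dotv_le_enorm u v; lra.
Qed.

Lemma enormZ a u : enorm (a *: u) = `|a| * enorm u.
Proof.
apply/eqP; rewrite -(@eqrXn2 _ 2)// ?mulr_ge0 ?enorm_ge0//.
by rewrite exprMn !enorm_sqr dotvZl dotvZr real_normK ?num_real// expr2 mulrA.
Qed.

Lemma enormN u : enorm (- u) = enorm u.
Proof. by rewrite -scaleN1r enormZ normrN1 mul1r. Qed.

Lemma enormB u v : enorm (u - v) <= enorm u + enorm v.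
Proof. by rewrite (le_trans (enormD _ _))// enormN. Qed.

Lemma enorm0 : enorm (0 : 'cV[R]_d) = 0.
Proof. by rewrite -(scale0r 0) enormZ normr0 mul0r. Qed.

Lemma enorm_eq0 u : enorm u = 0 -> u = 0.
Proof. by move=> u0; apply: dotvv_eq0; rewrite -enorm_sqr u0 expr0n. Qed.

Lemma enorm_sum (I : Type) (r : seq I) (p : pred I) (F : I -> 'cV[R]_d) :
  enorm (\sum_(i <- r | p i) F i) <= \sum_(i <- r | p i) enorm (F i).
Proof.
elim/big_ind2 : _ => // [|x a y b xa yb]; first by rewrite enorm0.
by rewrite (le_trans (enormD _ _))// lerD.
Qed.

Lemma quadratic_form_bounded B :
  exists2 C, 0 < C & forall v, `|dotv v (B *m v)| <= C * dotv v v.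
Proof.
exists (\sum_i \sum_j `|B i j| + 1).
  by rewrite ltr_wpDl// !sumr_ge0// => i _; rewrite sumr_ge0.
move=> v; rewrite mulrDl mul1r ler_wpDr ?dotvv_ge0//.
rewrite (le_trans (ler_norm_sum _ _ _))// mulr_suml ler_sum// => i _.
rewrite mxE mulr_sumr (le_trans (ler_norm_sum _ _ _))// mulr_suml ler_sum// => j _.
rewrite mulrCA normrM ler_wpM2l// normrM.
have := coord_le_enorm v i; have := coord_le_enorm v j.
by rewrite -enorm_sqr expr2 => vj vi; rewrite ler_pM.
Qed.

(** The Cauchy-Schwarz inequality of the form [B] for the pair [v, B^-1 v]
    bounds [|v|^2] by a multiple of the form at [v], because the form of
    [B^-1] is bounded. *)
Lemma psd_unit_coercive B : B^T = B -> (forall x, 0 <= dotv x (B *m x)) ->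
  B \in unitmx ->
  exists2 c, 0 < c & forall v, c * dotv v v <= dotv v (B *m v).
Proof.
move=> sB psdB uB; have [C C0 HC] := quadratic_form_bounded (invmx B).
exists C^-1; first by rewrite invr_gt0.
move=> v; rewrite mulrC ler_pdivrMr//.
have := dotvv_ge0 v; rewrite le_eqVlt => /predU1P[<-|v0].
  by rewrite mulr_ge0// ltW.
have := psd_cauchy_schwarz v (invmx B *m v) sB psdB.
rewrite mulKVmx// (dotvC _ v) => CS.
rewrite -(ler_pM2r v0) -expr2 (le_trans CS)// -mulrA ler_wpM2l//.
by rewrite (le_trans (ler_norm _))// HC.
Qed.

(** The infimum [mu] of the Rayleigh quotient is an eigenvalue: otherwise the
    positive semidefinite matrix [B - mu] would be invertible, hence coercive,
    and the infimum would exceed [mu]. *)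
Lemma min_rayleigh_eigenvalue B : (0 < d)%N -> B^T = B ->
  exists2 mu, eigenvalue B mu & forall v, mu * dotv v v <= dotv v (B *m v).
Proof.
move=> d0 sB.
pose E := [set dotv v (B *m v) | v in [set v | dotv v v = 1]].
have [C C0 HC] := quadratic_form_bounded B.
have E0 : E !=set0.
  exists (dotv (delta_mx (Ordinal d0) 0) (B *m delta_mx (Ordinal d0) 0)).
  exists (delta_mx (Ordinal d0) 0) => //=.
  rewrite /dotv (bigD1 (Ordinal d0))//= !mxE !eqxx mulr1 big1 ?addr0//.
  by move=> i /negbTE ni; rewrite !mxE ni mul0r.
have lE : has_lbound E.
  exists (- C) => _ [v /= v1 <-].
  by have := HC v; rewrite v1 mulr1 ler_norml => /andP[].
have muP v : inf E * dotv v v <= dotv v (B *m v).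
  have := dotvv_ge0 v; rewrite le_eqVlt => /predU1P[v0|v0].
    have := esym v0 => /dotvv_eq0 ->.
    by rewrite mulmx0 -(scale0r 0) !dotvZr !mul0r mulr0.
  have nv0 : 0 < enorm v by rewrite lt0r enorm_ge0 andbT -sqrf_eq0 enorm_sqr gt_eqF.
  have : inf E <= dotv ((enorm v)^-1 *: v) (B *m ((enorm v)^-1 *: v)).
    apply: ge_inf => //; exists ((enorm v)^-1 *: v) => //=.
    by rewrite dotvZl dotvZr -enorm_sqr; field; exact: lt0r_neq0.
  rewrite -scalemxAr dotvZl dotvZr mulrA -invfM -expr2 enorm_sqr.
  by rewrite mulrC ler_pdivlMr.
exists (inf E) => //.
apply: contraT => neig.
pose M := B - (inf E)%:M.
have ME v : dotv v (M *m v) = dotv v (B *m v) - inf E * dotv v v.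
  by rewrite mulmxBl mul_scalar_mx dotvBr dotvZr.
have uM : M \in unitmx.
  by rewrite -row_free_unit -kermx_eq0; move: neig; rewrite /eigenvalue negbK.
have sM : M^T = M by rewrite linearB/= sB tr_scalar_mx.
have psdM v : 0 <= dotv v (M *m v) by rewrite ME subr_ge0.
have [c c0 Hc] := psd_unit_coercive sM psdM uM.
have : inf E + c <= inf E.
  apply: lb_le_inf => // _ [v /= v1 <-].
  by have := Hc v; rewrite ME v1 !mulr1; lra.
by rewrite gerDl leNgt c0.
Qed.

(** [eigenvalue] refers to row eigenvectors, hence the transpose. *)
Lemma eigenvalue_quadratic_form B a : eigenvalue B a ->
  exists2 v, 0 < dotv v v & dotv v (B^T *m v) = a * dotv v v.
Proof.
move=> /eigenvalueP[v vB v0]; exists v^T.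
  rewrite lt0r dotvv_ge0 andbT; apply: contraNneq v0 => /dotvv_eq0/(congr1 trmx).
  by rewrite trmxK trmx0 => ->.
by rewrite -trmx_mul vB linearZ/= dotvZr.
Qed.

Lemma eigenvalue_rayleigh_le B a C : (forall v, `|dotv v (B^T *m v)| <= C * dotv v v) ->
  eigenvalue B a -> - C <= a <= C.
Proof.
move=> HC /eigenvalue_quadratic_form[v v0 Ev]; have := HC v.
by rewrite Ev normrM (ger0_norm (ltW v0)) ler_pM2r// ler_norml.
Qed.

(** [lambda_min B] is the infimum of a set which is bounded below and which
    contains the minimum of the Rayleigh quotient. *)
Lemma lambda_min_rayleigh B v : (0 < d)%N -> B^T = B ->
  lambda_min B * dotv v v <= dotv v (B *m v).
Proof.
move=> d0 sB; have [mu eig_mu muP] := min_rayleigh_eigenvalue d0 sB.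
have [C C0 HC] := quadratic_form_bounded B^T.
apply: le_trans (muP v); rewrite ler_wpM2r ?dotvv_ge0//.
apply: ge_inf => //; exists (- C) => a /(eigenvalue_rayleigh_le HC).
by case/andP.
Qed.

(** This is the case of the smallest eigenvalue, applied to [- B]. *)
Lemma lambda_max_rayleigh B v : (0 < d)%N -> B^T = B ->
  dotv v (B *m v) <= lambda_max B * dotv v v.
Proof.
move=> d0 sB; have sNB : (- B)^T = - B by rewrite linearN/= sB.
have [mu eig_mu muP] := min_rayleigh_eigenvalue d0 sNB.
have [C C0 HC] := quadratic_form_bounded B^T.
have := muP v; rewrite mulNmx dotvNr lerNr -mulNr => /le_trans; apply.
rewrite ler_wpM2r ?dotvv_ge0//.
apply: ub_le_sup => //.
  by exists C => a /(eigenvalue_rayleigh_le HC) => /andP[].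
move/eigenvalueP : eig_mu => [x xB x0]; apply/eigenvalueP; exists x => //.
by apply: oppr_inj; rewrite -mulmxN xB scaleNr opprK.
Qed.

(** Cauchy-Schwarz for the form of [B] at the pair [B v, v] bounds [|B v|^4]
    by [b |B v|^2 b |v|^2]. *)
Lemma psd_operator_norm B b v : B^T = B -> (forall x, 0 <= dotv x (B *m x)) ->
  0 <= b -> (forall x, dotv x (B *m x) <= b * dotv x x) ->
  enorm (B *m v) <= b * enorm v.
Proof.
move=> sB psdB b0 Bb.
rewrite -(@ler_pXn2r _ 2)// ?nnegrE ?mulr_ge0 ?enorm_ge0// exprMn !enorm_sqr.
have := dotvv_ge0 (B *m v); rewrite le_eqVlt => /predU1P[<-|y0].
  by rewrite mulr_ge0 ?sqr_ge0 ?dotvv_ge0.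
have := psd_cauchy_schwarz (B *m v) v sB psdB => CS.
rewrite -(ler_pM2r y0) -expr2 (le_trans CS)//.
rewrite (le_trans (ler_pM _ _ (Bb _) (Bb _)))//.
by rewrite mulrACA -expr2 mulrCA [leRHS]mulrC.
Qed.

End Euclid.

(** * The descent lemma *)

Section Smooth.
Context {R : realType} {d : nat}.
Variable V : 'cV[R]_d -> R.
Hypothesis dV : forall t, differentiable V t.

Lemma derive_dotv_grad (t u : 'cV[R]_d) : 'D_u V t = dotv (grad V t) u.
Proof.
rewrite deriveE//.
have -> : u = \sum_(i < d) u i 0 *: delta_mx i 0.
  by rewrite [LHS]matrix_sum_delta; apply: eq_bigr => i _; rewrite big_ord1.
rewrite linear_sum/= /dotv.
apply: eq_bigr => i _; rewrite linearZ/= mxE deriveE// mulrC; congr (_ * _).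
rewrite summxE (bigD1 i)//= !mxE !eqxx mulr1 big1 ?addr0//.
by move=> j ji; rewrite !mxE eq_sym (negbTE ji) mulr0.
Qed.

Lemma is_derive_along_line (t u : 'cV[R]_d) (s : R) :
  is_derive s 1 (fun s => V (t + s *: u)) (dotv (grad V (t + s *: u)) u).
Proof.
have E : (fun h : R => h^-1 *: (((fun s => V (t + s *: u)) \o shift s) (h *: 1)
             - V (t + s *: u))) =
         (fun h => h^-1 *: ((V \o shift (t + s *: u)) (h *: u) - V (t + s *: u))).
  by apply/funext => h /=; rewrite [h *: 1]mulr1 scalerDl addrCA.
rewrite -derive_dotv_grad; split.
  by rewrite /derivable E; exact: diff_derivable.
by rewrite /derive E.
Qed.

Section Lipschitz.
Variable L : R.
Hypothesis gradL : forall t t', enorm (grad V t - grad V t') <= L * enorm (t - t').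

(** Along the segment from [t] to [t + u] the function
    [s |-> V (t + s u) - s <grad V t, u> - s^2 L |u|^2 / 2] is nonincreasing:
    its derivative is [<grad V (t + s u) - grad V t, u> - s L |u|^2]. *)
Lemma descent (t u : 'cV[R]_d) :
  V (t + u) <= V t + dotv (grad V t) u + L / 2 * enorm u ^+ 2.
Proof.
pose a := dotv (grad V t) u; pose b := L / 2 * enorm u ^+ 2.
pose psi := (fun s : R => V (t + s *: u)) - (a \*: (@id R) + b \*: ((@id R) ^+ 2)).
have dpsi (s : R) : is_derive s 1 psi
    (dotv (grad V (t + s *: u)) u - (a + b * (2 * s))).
  have := is_derive_along_line t u s => ?.
  apply: is_deriveB; apply: is_derive_eq.
  by rewrite expr1 /GRing.scale/= !mulr1.
have : psi 1 <= psi 0.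
  apply: (@ler0_derive1_le_cc _ psi 0 1); rewrite ?in_itv/= ?lexx ?ler01//.
  - move=> s; rewrite in_itv/= => /andP[s0 _].
    rewrite derive1E; case: (dpsi s) => _ ->.
    rewrite opprD addrA -dotvBl subr_le0.
    rewrite (le_trans (dotv_le_enorm _ _))//.
    rewrite (le_trans (ler_wpM2r (enorm_ge0 _) (gradL _ _)))//.
    rewrite addrAC subrr add0r enormZ gtr0_norm// /b expr2.
    lra.
  - by apply: derivable_within_continuous => s _; case: (dpsi s).
rewrite /psi !fctE /= scale1r scale0r addr0.
by rewrite /GRing.scale/= -/a -/b !expr2; lra.
Qed.

End Lipschitz.
End Smooth.

(** * Conditional expectations and bounded factors *)

Section BoundedIntegrable.
Context {R : realType} {dO : measure_display} {Omega : measurableType dO}.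
Variable P : probability Omega R.

Definition bounded_by_cst (f : Omega -> R) := exists M, forall w, `|f w| <= M.

Lemma bounded_by_cst_bounded f : bounded_by_cst f -> [bounded f x | x in [set: Omega]].
Proof.
move=> [M fM]; exists M; split => [|y My x _]; first exact: num_real.
exact: le_trans (fM x) (ltW My).
Qed.

Lemma integrable_bounded_fun (f : Omega -> R) :
  measurable_fun setT f -> bounded_by_cst f -> P.-integrable setT (EFin \o f).
Proof.
move=> mf bf; apply: measurable_bounded_integrable => //.
  by apply: (le_lt_trans (probability_le1 P measurableT)); rewrite ltry.
exact: bounded_by_cst_bounded.
Qed.

Lemma integrable_cst_fun (r : R) : P.-integrable setT (EFin \o (fun _ => r)).
Proof. by apply: integrable_bounded_fun => //; exists `|r|. Qed.

Lemma integrable_bounded_mul (Z f : Omega -> R) :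
  measurable_fun setT Z -> bounded_by_cst Z -> P.-integrable setT (EFin \o f) ->
  P.-integrable setT (EFin \o (fun w => Z w * f w)).
Proof.
move=> mZ bZ If.
by have := integrableMr measurableT mZ (bounded_by_cst_bounded bZ) If.
Qed.

Lemma Rintegral_setT_cst (r : R) : \int[P]_w r = r.
Proof.
by rewrite Rintegral_cst// [X in _ * X](_ : _ = 1) ?mulr1// /= probability_setT.
Qed.

Variable C : set (set Omega).
Hypothesis subC : <<s C>> `<=` measurable.

(** Measurability for a sub-sigma-algebra is measurability on the type that
    carries it, so that the closure properties of measurable functions apply. *)
Lemma measurable_wrtE d' (S : measurableType d') (f : Omega -> S) :
  measurable_wrt <<s C>> f <->
  measurable_fun (T := g_sigma_algebraType C) setT f.
Proof.
split => [mf _ B mB|mf _ [B mB <-]].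
  by apply: mf; exists B.
exact: mf.
Qed.

Lemma measurable_fun_sub_sigma d' (S : measurableType d') (f : Omega -> S) :
  measurable_fun (T := g_sigma_algebraType C) setT f -> measurable_fun setT f.
Proof. by move=> mf mT B mB; apply: subC; exact: mf. Qed.

(** Let [0 <= Z <= M] and [A = (Z >= M/2)]. Removing [(M/2) 1_A] from [Z]
    does not change the integral of [Z D] and leaves a function with values in
    [[0, M/2]]. Iterating, the integral is at most [M / 2^n] times that of
    [|D|], for all [n]. *)
Lemma Rintegral_mul_le_halving (D : Omega -> R) (n : nat) (M : R) (Z : Omega -> R) :
  P.-integrable setT (EFin \o D) ->
  (forall A, <<s C>> A -> \int[P]_(w in A) D w = 0) ->
  measurable_fun (T := g_sigma_algebraType C) setT Z ->
  (forall w, 0 <= Z w <= M) ->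
  `|\int[P]_w (Z w * D w)| <= M / 2 ^+ n * \int[P]_w `|D w|.
Proof.
move=> ID D0; elim: n M Z => [|n IH] M Z mZ Z0.
  have bZ : bounded_by_cst Z.
    by exists M => w; have /andP[z0 zM] := Z0 w; rewrite ger0_norm.
  have IZD := integrable_bounded_mul (measurable_fun_sub_sigma mZ) bZ ID.
  rewrite expr0 divr1 (le_trans (le_normr_Rintegral _ _))// -RintegralZl//; last first.
    exact: integrable_norm.
  apply: le_Rintegral => //; first exact: integrable_norm.
    by have := integrableZl measurableT M (integrable_norm ID).
  move=> w _; rewrite normrM ler_wpM2r//.
  by have /andP[z0 zM] := Z0 w; rewrite ger0_norm.
pose A := [set w | M / 2 <= Z w].
have CA : <<s C>> A.
  have -> : A = setT `&` Z @^-1` `[M / 2, +oo[.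
    by apply/seteqP; split => w /=; rewrite in_itv/= andbT => // -[].
  by apply: mZ => //; exact: measurable_itv.
have AE w : \1_A w = ((M / 2 <= Z w)%R)%:R :> R.
  by rewrite indicE; congr ((nat_of_bool _)%:R); apply/idP/idP; rewrite inE.
pose Z' w := Z w - M / 2 * \1_A w.
have mA : measurable_fun (T := g_sigma_algebraType C) setT (\1_A : Omega -> R).
  exact: measurable_indic.
have mZ' : measurable_fun (T := g_sigma_algebraType C) setT Z'.
  by apply: measurable_funB => //; exact: measurable_funM.
have Z'0 w : 0 <= Z' w <= M / 2.
  rewrite /Z' AE; have := Z0 w.
  by case: (leP (M / 2) (Z w)) => /= hM /andP[z0 zM]; apply/andP; split; lra.
have := IH _ _ mZ' Z'0.
rewrite exprS invfM mulrA; congr (`|_| <= _).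
have mA' := measurable_fun_sub_sigma mA.
have bA : bounded_by_cst (\1_A : Omega -> R).
  by exists 1 => w; rewrite AE; case: (M / 2 <= Z w); rewrite ?normr1 ?normr0.
have IA := integrable_bounded_mul mA' bA ID.
have bZ : bounded_by_cst Z.
  by exists M => w; have /andP[z0 zM] := Z0 w; rewrite ger0_norm.
have IZD := integrable_bounded_mul (measurable_fun_sub_sigma mZ) bZ ID.
have -> : \int[P]_w (Z' w * D w) =
    \int[P]_w (Z w * D w - M / 2 * (\1_A w * D w)).
  by apply: eq_Rintegral => w _; rewrite /Z'; ring.
rewrite RintegralB//; last by have := integrableZl measurableT (M / 2) IA.
rewrite RintegralZl// [X in _ - _ * X](_ : _ = 0) ?mulr0 ?subr0//.
rewrite -(D0 A CA) [RHS]Rintegral_mkcond; apply: eq_Rintegral => w _.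
by rewrite patchE indicE; case: (w \in A); rewrite ?mul1r ?mul0r.
Qed.

(** After adding a constant to [Z], which is harmless because [D] integrates to
    zero, the bounds of the previous lemma apply, and tend to zero with [n]. *)
Lemma Rintegral_bounded_mul_eq0 (D Z : Omega -> R) :
  P.-integrable setT (EFin \o D) ->
  (forall A, <<s C>> A -> \int[P]_(w in A) D w = 0) ->
  measurable_fun (T := g_sigma_algebraType C) setT Z -> bounded_by_cst Z ->
  \int[P]_w (Z w * D w) = 0.
Proof.
move=> ID D0 mZ [M ZM].
pose Z' w := Z w + M.
have mZ' : measurable_fun (T := g_sigma_algebraType C) setT Z'.
  exact: measurable_funD.
have Z'0 w : 0 <= Z' w <= M + M.
  by have := ZM w; rewrite ler_norml /Z' => /andP[z0 zM]; apply/andP; split; lra.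
have -> : \int[P]_w (Z w * D w) = \int[P]_w (Z' w * D w).
  under [RHS]eq_Rintegral do rewrite mulrDl.
  rewrite RintegralD//.
  - rewrite RintegralZl// D0 ?mulr0 ?addr0//.
    exact: (@measurableT _ (g_sigma_algebraType C)).
  - by apply: integrable_bounded_mul => //; [exact: measurable_fun_sub_sigma|exists M].
  - by have := integrableZl measurableT M ID.
apply/eqP; rewrite -normr_eq0 eq_le normr_ge0 andbT.
set I := `|_|; set c := (M + M) * \int[P]_w `|D w|.
have Ic n : I <= c / 2 ^+ n.
  by rewrite /c mulrAC; exact: Rintegral_mul_le_halving.
have c2 : (fun n => c / 2 ^+ n) @ \oo --> 0.
  rewrite -(mulr0 c); apply: cvgM; first exact: cvg_cst.
  under eq_fun do rewrite -exprVn.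
  by apply: cvg_expr; rewrite ger0_norm// invf_lt1// ltr1n.
rewrite -(cvg_lim _ c2)//.
apply: limr_ge; first by apply/cvg_ex; exists 0.
by apply: nearW.
Qed.

Lemma cond_exp_Rintegral_mul (Xc Y Z : Omega -> R) :
  is_cond_exp P <<s C>> Xc Y ->
  measurable_fun (T := g_sigma_algebraType C) setT Z -> bounded_by_cst Z ->
  \int[P]_w (Z w * Xc w) = \int[P]_w (Z w * Y w).
Proof.
move=> [IX IY mY XY] mZ bZ.
have mZ' := measurable_fun_sub_sigma mZ.
apply/eqP; rewrite -subr_eq0 -RintegralB//; try exact: integrable_bounded_mul.
under eq_Rintegral do rewrite -mulrBr.
apply/eqP; apply: Rintegral_bounded_mul_eq0 => //.
  by have := integrableB measurableT IX IY.
move=> A CA; have mA := subC CA.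
rewrite RintegralB//; try by apply: integrableS measurableT mA _ _.
by rewrite /Rintegral XY// subrr.
Qed.
End BoundedIntegrable.

(** * Measurability of continuous functions of random vectors *)

Section ContinuousMeasurable.
Context {R : realType} {d : nat}.

Definition grid_round (k : nat) (x : R) : R :=
  (Num.floor (k.+1%:R * x))%:~R / k.+1%:R.

Lemma grid_round_dist k x : `|x - grid_round k x| <= k.+1%:R^-1.
Proof.
have k0 : 0 < k.+1%:R :> R by rewrite ltr0Sn.
have := eqxx (Num.floor (k.+1%:R * x)).
rewrite floor_eq intrD => /andP[f1 f2].
rewrite /grid_round -[x in x - _](mulKf (lt0r_neq0 k0)) mulrC -mulrBl normrM.
rewrite (gtr0_norm (_ : 0 < k.+1%:R^-1)) ?invr_gt0// ler_piMl ?invr_ge0 ?ltW//.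
by rewrite ger0_norm; lra.
Qed.

(** [f] is the pointwise limit of its composites with the rounding to the grid
    of mesh [1/(k+1)]; such a composite is measurable because the grid is
    countable. *)
Lemma measurable_comp_continuous d' (T : measurableType d')
    (g : T -> 'cV[R]_d) (f : 'cV[R]_d -> R) : continuous f ->
  (forall i, measurable_fun setT (fun w => g w i 0)) ->
  measurable_fun setT (f \o g).
Proof.
move=> cf mg.
pose rnd k (v : 'cV[R]_d) := \col_i grid_round k (v i 0).
apply: (@measurable_fun_cvg _ _ _ _ (fun k => f \o rnd k \o g)).
  move=> k _ B mB; rewrite setTI.
  pose pt (z : {ffun 'I_d -> int}) : 'cV[R]_d := \col_i ((z i)%:~R / k.+1%:R).
  have -> : (f \o rnd k \o g) @^-1` B =
    \bigcup_(z : {ffun 'I_d -> int}) ([set w | B (f (pt z))] `&`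
        \bigcap_(i in [set: 'I_d]) [set w | Num.floor (k.+1%:R * g w i 0) = z i]).
    apply/seteqP; split => w /=.
      move=> Bw; exists [ffun i => Num.floor (k.+1%:R * g w i 0)] => //; split.
        rewrite /= (_ : pt _ = rnd k (g w))//.
        by apply/matrixP => i j; rewrite !mxE ffunE.
      by move=> i _ /=; rewrite ffunE.
    move=> [z _ [/= Bz zE]].
    rewrite (_ : rnd k (g w) = pt z)//.
    by apply/matrixP => i j; rewrite !mxE /grid_round (zE i Logic.I).
  apply: countable_bigcupT_measurable; first exact: countableP.
  move=> z; apply: measurableI.
    have [Bz|Bz] := pselect (B (f (pt z))).
      by rewrite (_ : [set _ | _] = setT)//; apply/seteqP; split.
    by rewrite (_ : [set _ | _] = set0)//; apply/seteqP; split.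
  apply: fin_bigcap_measurable => // i _.
  have mki : measurable_fun setT (fun w => k.+1%:R * g w i 0).
    exact: measurable_funM.
  rewrite (_ : [set _ | _] = setT `&` (fun w => k.+1%:R * g w i 0) @^-1`
      `[(z i)%:~R, (z i + 1)%:~R[).
    by apply: mki => //; exact: measurable_itv.
  rewrite setTI; apply/seteqP; split => w /=; rewrite in_itv/= -floor_eq.
    by move=> ->.
  by move/eqP.
move=> w _ /=.
have rg : (fun k => rnd k (g w)) @ \oo --> g w.
  apply/cvgrPdist_le => e e0; near=> k.
  rewrite [leLHS]mx_normrE; apply: bigmax_le; first exact: ltW.
  move=> [i j] _ /=; rewrite !mxE ord1.
  rewrite (le_trans (grid_round_dist _ _))//.
  by near: k; have := near_infty_natSinv_lt (PosNum e0); apply: filterS => k /ltW.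
apply: (cvg_comp _ _ rg); exact: cf.
Unshelve. all: by end_near. Qed.

Lemma enorm_le_mx_norm (v : 'cV[R]_d) : enorm v <= Num.sqrt d%:R * `|v|.
Proof.
rewrite -(@ler_pXn2r _ 2)// ?nnegrE ?mulr_ge0 ?sqrtr_ge0 ?enorm_ge0//.
rewrite enorm_sqr exprMn sqr_sqrtr// /dotv.
have -> : d%:R * `|v| ^+ 2 = \sum_(i < d) `|v| ^+ 2.
  by rewrite sumr_const card_ord mulr_natl.
rewrite ler_sum// => i _; rewrite -expr2 -real_normK ?num_real// lerXn2r ?nnegrE//.
rewrite [leRHS]/Num.norm/= mx_normrE.
by apply: (le_bigmax _ (fun ij => `|v ij.1 ij.2|) (i, 0)).
Qed.

Lemma enorm_lipschitz_continuous (f : 'cV[R]_d -> R) (L : R) :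
  (forall t t', `|f t - f t'| <= L * enorm (t - t')) -> continuous f.
Proof.
move=> fL t; apply/(@cvgrPdist_le _ _ _ (nbhs t) _) => e e0.
pose c := `|L| * Num.sqrt d%:R + 1.
have c0 : 0 < c by rewrite ltr_wpDl// mulr_ge0// sqrtr_ge0.
near=> t'.
have tt' : `|t - t'| <= e / c.
  near: t'; apply: (cvgrPdist_le _ _).1 => //; exact: divr_gt0.
rewrite (le_trans (fL _ _))// (@le_trans _ _ (`|L| * enorm (t - t')))//.
  by rewrite ler_wpM2r ?enorm_ge0// ler_norm.
rewrite (le_trans (ler_wpM2l _ (enorm_le_mx_norm _)))// mulrA.
rewrite ler_pdivlMr// mulrC in tt'.
by rewrite (le_trans _ tt')// ler_wpM2r// lerDl.
Unshelve. all: by end_near. Qed.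

End ContinuousMeasurable.

(** * Expected decrease in one preconditioned step *)

Section RealExpectation.
Context {R : realType} {dO : measure_display} {Omega : measurableType dO}.
Variable P : probability Omega R.

Lemma integrable_sum_fun (I : Type) (s : seq I) (F : I -> Omega -> R) :
  (forall i, P.-integrable setT (EFin \o F i)) ->
  P.-integrable setT (EFin \o (fun w => \sum_(i <- s) F i w)).
Proof.
move=> IF.
have := @integrable_sum _ _ _ P _ measurableT I s xpredT _ (fun i _ => IF i).
by apply: eq_integrable => // w _ /=; rewrite sumEFin.
Qed.

Lemma Rintegral_sum (I : Type) (s : seq I) (F : I -> Omega -> R) :
  (forall i, P.-integrable setT (EFin \o F i)) ->
  \int[P]_w (\sum_(i <- s) F i w) = \sum_(i <- s) \int[P]_w F i w.
Proof.
move=> IF; elim: s => [|i s IH].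
  by under eq_Rintegral do rewrite big_nil; rewrite big_nil Rintegral_setT_cst.
under eq_Rintegral do rewrite big_cons.
by rewrite RintegralD ?big_cons ?IH//; exact: integrable_sum_fun.
Qed.

(** Almost everywhere [g - f] equals its absolute value. *)
Lemma le_Rintegral_ae (f g : Omega -> R) :
  P.-integrable setT (EFin \o f) -> P.-integrable setT (EFin \o g) ->
  {ae P, forall w, f w <= g w} -> \int[P]_w f w <= \int[P]_w g w.
Proof.
move=> If Ig fg; rewrite -subr_ge0 -RintegralB//.
have Igf : P.-integrable setT (EFin \o (fun w => g w - f w)).
  by have := integrableB measurableT Ig If.
rewrite (_ : \int[P]_w _ = \int[P]_w `|g w - f w|); first exact: Rintegral_ge0.
have mgf := measurable_int P Igf.
congr fine; apply: ae_eq_integral => //.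
  apply/measurable_EFinP; apply: measurableT_comp => //; exact/measurable_EFinP.
by apply: filterS fg => w fgw _ /=; rewrite ger0_norm// subr_ge0.
Qed.

Lemma EFin_Rintegral (f : Omega -> R) : P.-integrable setT (EFin \o f) ->
  (\int[P]_w f w)%:E = (\int[P]_w (f w)%:E)%E.
Proof. by move=> If; rewrite fineK//; exact: integrable_fin_num. Qed.

(** By duality: [|h|^2 = int <h, f> <= |h| G] for [h] the integral of [f]. *)
Lemma enorm_Rintegral_le d (f : Omega -> 'cV[R]_d) (G : R) :
  (forall i, measurable_fun setT (fun w => f w i 0)) ->
  (forall w, enorm (f w) <= G) ->
  enorm (\col_i \int[P]_w f w i 0) <= G.
Proof.
move=> mf fG; set h := \col_i _.
have If i : P.-integrable setT (EFin \o (fun w => f w i 0)).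
  apply: integrable_bounded_fun => //; exists G => w.
  exact: le_trans (coord_le_enorm _ _) (fG w).
have Ihf i : P.-integrable setT (EFin \o (fun w => h i 0 * f w i 0)).
  by have := integrableZl measurableT (h i 0) (If i).
have hE : enorm h ^+ 2 = \int[P]_w dotv h (f w).
  rewrite enorm_sqr /dotv Rintegral_sum//.
  by apply: eq_bigr => i _; rewrite RintegralZl// {2}/h mxE.
have : enorm h * enorm h <= enorm h * G.
  rewrite -expr2 hE -[leRHS](Rintegral_setT_cst P).
  apply: le_Rintegral => //.
  - exact: integrable_sum_fun.
  - exact: integrable_cst_fun.
  - by move=> w _; rewrite (le_trans (dotv_le_enorm _ _))// ler_wpM2l// enorm_ge0.
have := enorm_ge0 h; rewrite le_eqVlt => /predU1P[<- _|h0].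
  exact: le_trans (enorm_ge0 (f point)) (fG point).
by rewrite ler_pM2l.
Qed.

End RealExpectation.

Section DescentStep.
Context {R : realType} {dO : measure_display} {Omega : measurableType dO}.
Variable P : probability Omega R.
Variable C : set (set Omega).
Hypothesis subC : <<s C>> `<=` measurable.
Context {d : nat}.
Variables (V : 'cV[R]_d -> R) (Vmin L : R).
Hypothesis dV : forall t, differentiable V t.
Hypothesis VminV : forall t, Vmin <= V t.
Hypothesis L0 : 0 <= L.
Hypothesis gradL :
  forall t t', enorm (grad V t - grad V t') <= L * enorm (t - t').

(** The upper bound is the descent lemma at the origin. *)
Lemma bounded_on_ball M : exists B, forall t, enorm t <= M -> `|V t| <= B.
Proof.
pose B := `|V 0| + enorm (grad V 0) * M + L / 2 * M ^+ 2.
exists (`|Vmin| + `|B|) => t tM.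
have M0 : 0 <= M := le_trans (enorm_ge0 t) tM.
have VB : V t <= B.
  rewrite -[t]add0r (le_trans (descent dV gradL 0 t))// lerD//.
    rewrite lerD ?ler_norm// (le_trans (dotv_le_enorm _ _))//.
    by rewrite ler_wpM2l// enorm_ge0.
  by rewrite ler_wpM2l ?divr_ge0// lerXn2r ?nnegrE ?enorm_ge0.
have := VminV t => mV; rewrite ler_norml; apply/andP; split.
  have := ler_norm (- Vmin); rewrite normrN; have := normr_ge0 B; lra.
have := ler_norm B; have := normr_ge0 Vmin; lra.
Qed.

Lemma grad_coord_continuous i : continuous (fun t => grad V t i 0).
Proof.
apply: (@enorm_lipschitz_continuous _ _ _ L) => t t'.
rewrite (le_trans _ (gradL t t'))// (le_trans _ (coord_le_enorm _ i))//.
by rewrite !mxE.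
Qed.

Lemma integrable_objective (th : Omega -> 'cV[R]_d) M :
  (forall i, measurable_fun setT (fun w => th w i 0)) ->
  (forall w, enorm (th w) <= M) ->
  P.-integrable setT (EFin \o (V \o th)).
Proof.
move=> mth bth; have [B VB] := bounded_on_ball M.
apply: integrable_bounded_fun; last by exists B => w; exact: VB.
by apply: measurable_comp_continuous mth => t; exact: differentiable_continuous.
Qed.

Variables (th : Omega -> 'cV[R]_d) (A : Omega -> 'M[R]_d).
Variables (g Y : Omega -> 'cV[R]_d).
Variables (M G B lo hi gam b v : R).
Local Notation OC := (g_sigma_algebraType C).
Hypothesis mth : forall i, measurable_fun (T := OC) setT (fun w => th w i 0).
Hypothesis mA : forall i j, measurable_fun (T := OC) setT (fun w => A w i j).
Hypothesis bth : forall w, enorm (th w) <= M.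
Hypothesis gradG : forall w, enorm (grad V (th w)) <= G.
Hypothesis gB : forall w, enorm (g w) <= B.
Hypothesis symA : forall w, (A w)^T = A w.
Hypothesis loA : forall w x, lo * dotv x x <= dotv x (A w *m x).
Hypothesis hiA : forall w x, dotv x (A w *m x) <= hi * dotv x x.
Hypothesis lo0 : 0 < lo.
Hypothesis hi0 : 0 <= hi.
Hypothesis gam0 : 0 <= gam.
Hypothesis gY : is_cond_exp_vec P <<s C>> g Y.
Hypothesis bias : {ae P, forall w, enorm (Y w - grad V (th w)) <= b}.
Hypothesis second_moment : \int[P]_w (enorm (g w) ^+ 2) <= v.

(** The lower bound on the form makes it positive semidefinite, so that the
    upper bound controls the operator norm. *)
Lemma enorm_precond_le w x : enorm (A w *m x) <= hi * enorm x.
Proof.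
apply: psd_operator_norm => // y.
by rewrite (le_trans _ (loA w y))// mulr_ge0 ?dotvv_ge0// ltW.
Qed.

Lemma measurable_precond_grad i :
  measurable_fun (T := OC) setT (fun w => (A w *m grad V (th w)) i 0).
Proof.
under eq_fun do rewrite mxE.
apply: measurable_sum => j; apply: measurable_funM => //.
exact: (measurable_comp_continuous (@grad_coord_continuous j)).
Qed.

Lemma measurable_sq_grad :
  measurable_fun (T := OC) setT (fun w => enorm (grad V (th w)) ^+ 2).
Proof.
under eq_fun do rewrite enorm_sqr.
apply: measurable_sum => j; apply: measurable_funM;
  exact: (measurable_comp_continuous (@grad_coord_continuous j)).
Qed.

Lemma integrable_sq_grad :
  P.-integrable setT (EFin \o (fun w => enorm (grad V (th w)) ^+ 2)).
Proof.
apply: integrable_bounded_fun.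
  exact: (measurable_fun_sub_sigma subC measurable_sq_grad).
exists (G ^+ 2) => w; rewrite normrX ger0_norm ?enorm_ge0//.
by rewrite lerXn2r ?nnegrE ?enorm_ge0// (le_trans (enorm_ge0 _) (gradG w)).
Qed.

(** The conditional expectation replaces [g] by [Y], which is within [b] of
    the gradient almost surely. *)
Lemma expected_inner_product_ge :
  lo * \int[P]_w (enorm (grad V (th w)) ^+ 2) - hi * G * b <=
  \int[P]_w dotv (grad V (th w)) (A w *m g w).
Proof.
pose Z w := A w *m grad V (th w).
have ZG w : enorm (Z w) <= hi * G.
  by rewrite (le_trans (enorm_precond_le _ _))// ler_wpM2l.
have mZ i : measurable_fun (T := OC) setT (fun w => Z w i 0).
  exact: measurable_precond_grad.
have bZ i : bounded_by_cst (fun w => Z w i 0).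
  by exists (hi * G) => w; exact: le_trans (coord_le_enorm _ _) (ZG w).
have IZg i : P.-integrable setT (EFin \o (fun w => Z w i 0 * g w i 0)).
  have [Ig _ _ _] := gY i.
  exact: integrable_bounded_mul (measurable_fun_sub_sigma subC (mZ i)) (bZ i) Ig.
have IZY i : P.-integrable setT (EFin \o (fun w => Z w i 0 * Y w i 0)).
  have [_ IY _ _] := gY i.
  exact: integrable_bounded_mul (measurable_fun_sub_sigma subC (mZ i)) (bZ i) IY.
have -> : \int[P]_w dotv (grad V (th w)) (A w *m g w) = \int[P]_w dotv (Z w) (Y w).
  under eq_Rintegral do rewrite dotv_mulmx_sym//.
  rewrite /dotv !Rintegral_sum//; apply: eq_bigr => i _.
  exact: (cond_exp_Rintegral_mul subC (gY i) (mZ i) (bZ i)).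
have Ilo := integrable_sq_grad.
have Ilo' : P.-integrable setT (EFin \o (fun w => lo * enorm (grad V (th w)) ^+ 2)).
  by have := integrableZl measurableT lo Ilo.
rewrite -RintegralZl// -[X in _ - X](Rintegral_setT_cst P).
rewrite -RintegralB//; last exact: integrable_cst_fun.
apply: le_Rintegral_ae.
- by have := integrableB measurableT Ilo' (integrable_cst_fun P (hi * G * b)).
- exact: integrable_sum_fun.
apply: filterS bias => w bw.
have -> : dotv (Z w) (Y w) =
    dotv (Z w) (grad V (th w)) + dotv (Z w) (Y w - grad V (th w)).
  by rewrite dotvBr addrC subrK.
apply: lerD; first by rewrite enorm_sqr [leRHS]dotvC; exact: loA.
rewrite -[leRHS]opprK lerN2 -dotvNr (le_trans (dotv_le_enorm _ _))// enormN.
by rewrite ler_pM ?enorm_ge0.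
Qed.

(** The inequality of the descent lemma, integrated. *)
Lemma expected_descent_step :
  gam * lo * \int[P]_w (enorm (grad V (th w)) ^+ 2) <=
  \int[P]_w V (th w) - \int[P]_w V (th w - gam *: (A w *m g w)) +
  gam * hi * G * b + L / 2 * gam ^+ 2 * hi ^+ 2 * v.
Proof.
have mg i : measurable_fun setT (fun w => g w i 0).
  by have [/measurable_int/measurable_EFinP] := gY i.
have mth' i := measurable_fun_sub_sigma subC (mth i).
have mA' i j := measurable_fun_sub_sigma subC (mA i j).
have mAg i : measurable_fun setT (fun w => (A w *m g w) i 0).
  under eq_fun do rewrite mxE.
  by apply: measurable_sum => j; exact: measurable_funM.
have mgrad i : measurable_fun setT (fun w => grad V (th w) i 0).
  exact: (measurable_comp_continuous (@grad_coord_continuous i)).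
have AgB w : enorm (A w *m g w) <= hi * B.
  by rewrite (le_trans (enorm_precond_le _ _))// ler_wpM2l.
have IV : P.-integrable setT (EFin \o (fun w => V (th w))).
  exact: integrable_objective mth' bth.
have IV' : P.-integrable setT (EFin \o (fun w => V (th w - gam *: (A w *m g w)))).
  apply: (@integrable_objective _ (M + gam * (hi * B))).
    move=> i; under eq_fun do rewrite !mxE.
    apply: measurable_funB => //; apply: measurable_funM => //.
    by have := mAg i; under eq_fun do rewrite mxE.
  move=> w; rewrite (le_trans (enormB _ _))// lerD// enormZ ger0_norm//.
  by rewrite ler_wpM2l.
have Iin : P.-integrable setT
    (EFin \o (fun w => dotv (grad V (th w)) (A w *m g w))).
  apply: integrable_bounded_fun.
    by apply: measurable_sum => i; exact: measurable_funM.
  exists (G * (hi * B)) => w; rewrite (le_trans (cauchy_schwarz _ _))//.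
  by rewrite ler_pM ?enorm_ge0.
have Ig2 : P.-integrable setT (EFin \o (fun w => enorm (g w) ^+ 2)).
  apply: integrable_bounded_fun.
    under eq_fun do rewrite enorm_sqr.
    by apply: measurable_sum => i; exact: measurable_funM.
  exists (B ^+ 2) => w; rewrite normrX ger0_norm ?enorm_ge0//.
  by rewrite lerXn2r ?nnegrE ?enorm_ge0// (le_trans (enorm_ge0 _) (gB w)).
pose c := L / 2 * gam ^+ 2 * hi ^+ 2.
have c0 : 0 <= c by rewrite /c !mulr_ge0 ?invr_ge0 ?sqr_ge0.
have Iin' : P.-integrable setT
    (EFin \o (fun w => gam * dotv (grad V (th w)) (A w *m g w))).
  by have := integrableZl measurableT gam Iin.
have Ig2' : P.-integrable setT (EFin \o (fun w => c * enorm (g w) ^+ 2)).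
  by have := integrableZl measurableT c Ig2.
have IVin : P.-integrable setT (EFin \o (fun w => V (th w) -
    gam * dotv (grad V (th w)) (A w *m g w))).
  by have := integrableB measurableT IV Iin'.
have step : \int[P]_w V (th w - gam *: (A w *m g w)) <=
    \int[P]_w V (th w) - gam * \int[P]_w dotv (grad V (th w)) (A w *m g w) +
    c * \int[P]_w (enorm (g w) ^+ 2).
  rewrite -!RintegralZl// -RintegralB// -RintegralD//.
  apply: le_Rintegral => //.
    by have := integrableD measurableT IVin Ig2'.
  move=> w _; rewrite (le_trans (descent dV gradL _ _))//.
  rewrite dotvNr dotvZr lerD2l enormN enormZ ger0_norm// exprMn.
  have c'0 : 0 <= L / 2 * gam ^+ 2 by rewrite !mulr_ge0 ?invr_ge0 ?sqr_ge0.
  have e2 : enorm (A w *m g w) ^+ 2 <= (hi * enorm (g w)) ^+ 2.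
    rewrite lerXn2r ?nnegrE ?mulr_ge0 ?enorm_ge0//; exact: enorm_precond_le.
  by have := ler_wpM2l c'0 e2; rewrite exprMn /c !mulrA.
have cv : c * \int[P]_w (enorm (g w) ^+ 2) <= c * v by rewrite ler_wpM2l.
have := ler_wpM2l gam0 expected_inner_product_ge.
rewrite /c in step cv.
rewrite mulrBr [gam * (lo * _)]mulrA [gam * (_ * b)]mulrA [gam * (hi * _)]mulrA.
by move=> ge; lra.
Qed.

End DescentStep.

(** * Boundedness of the estimator and sampling of the index *)

Section EstimatorBounds.
Context {R : realType} {d : nat} {dS : measure_display} {S : measurableType dS}.

Lemma enorm_le_sup_enorm (f : S -> 'cV[R]_d) (G : R) :
  (sup_enorm f <= G%:E)%E -> forall x, enorm (f x) <= G.
Proof.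
move=> fG x; rewrite -lee_fin; apply: le_trans fG.
by apply: ereal_sup_ubound; exists x.
Qed.

Lemma enorm_traj_mean_le (h : S -> 'cV[R]_d) (G : R) (p : nat) (x : nat -> S) :
  0 <= G -> (forall y, enorm (h y) <= G) -> enorm (traj_mean h p x) <= G.
Proof.
move=> G0 hG; rewrite /traj_mean enormZ ger0_norm ?invr_ge0//.
case: p => [|p]; first by rewrite invr0 mul0r.
rewrite mulrC ler_pdivrMr ?ltr0Sn// (le_trans (enorm_sum _ _ _))//.
rewrite (@le_trans _ _ (\sum_(1 <= i < p.+2) G))//; first exact: ler_sum.
by rewrite sumr_const_nat subn1 /= mulr_natr.
Qed.

(** The truncation makes the estimator bounded, whatever the value of [k]:
    the correction term is absent as soon as [2 ^ k > T]. *)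
Lemma enorm_mlmc_estimator_le (h : S -> 'cV[R]_d) (G T : R) (k : nat)
    (x : nat -> S) : 0 <= G -> 0 <= T -> (forall y, enorm (h y) <= G) ->
  enorm (mlmc_estimator h T k x) <= G + T * (G + G).
Proof.
move=> G0 T0 hG; rewrite /mlmc_estimator (le_trans (enormD _ _))// lerD//.
rewrite enormZ ler_pM ?enorm_ge0//; last first.
  by rewrite (le_trans (enormB _ _))// lerD// enorm_traj_mean_le.
rewrite ger0_norm ?mulr_ge0//.
by case: (leP (2 ^ k)%:R T) => ?; rewrite ?mulr1 ?mulr0.
Qed.

End EstimatorBounds.

Section MLMCSigma.
Context {R : realType} {d : nat} {dS : measure_display} {S : measurableType dS}.
Context {dO : measure_display} {Omega : measurableType dO}.
Variables (K : nat -> Omega -> nat) (X : nat -> nat -> Omega -> S).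
Hypothesis mK : forall n, measurable_fun setT (K n).
Hypothesis mX : forall m i, measurable_fun setT (X m i).

(** The family whose generated sigma-algebra is, by definition,
    [mlmc_filtration K X n]: measurability for the past is stated in the type
    [g_sigma_algebraType] of this family. *)
Definition mlmc_past (n : nat) : set (set Omega) :=
  \bigcup_(m in [set m | (1 <= m <= n)%N])
    (sigma_rv (K m) `|` \bigcup_(i in [set i | (1 <= i)%N]) sigma_rv (X m i)).

Lemma mlmc_filtration_measurable n :
  mlmc_filtration K X n `<=` @measurable _ Omega.
Proof.
apply: smallest_sub; first exact: sigma_algebra_measurable.
move=> _ [m _ [|[i _]] [B mB <-]]; first exact: mK.
exact: mX.
Qed.

Lemma mlmc_sigma_measurable : mlmc_sigma K X `<=` @measurable _ Omega.
Proof.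
apply: smallest_sub; first exact: sigma_algebra_measurable.
by move=> B [n _]; exact: mlmc_filtration_measurable.
Qed.

Lemma mlmc_filtration_sub_sigma n : mlmc_filtration K X n `<=` mlmc_sigma K X.
Proof.
by apply: subset_trans (@sub_sigma_algebra _ _ _); exact: bigcup_sup.
Qed.

End MLMCSigma.

Lemma sum_nat_delta (R : pzRingType) (F : nat -> R) (j N : nat) :
  \sum_(0 <= n < N) F n * (j == n)%:R = if (j < N)%N then F j else 0.
Proof.
rewrite -(big_nat1_eq +%R F j 0 N) [RHS]big_mkcond/=.
apply: eq_bigr => n _.
by rewrite eq_sym; case: eqVneq => _; rewrite ?mulr1 ?mulr0.
Qed.

Section IndependentIndex.
Context {R : realType} {dO : measure_display} {Omega : measurableType dO}.
Variable P : probability Omega R.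
Variable C : set (set Omega).
Hypothesis subC : <<s C>> `<=` measurable.
Variable J : {RV P >-> nat}.
Hypothesis indepJ : indep_of P J <<s C>>.
Variables (N : nat) (p : nat -> R).
Hypothesis pJ : forall n, (n <= N)%N -> P (J @^-1` [set n]) = (p n)%:E.
Hypothesis sum_p : \sum_(0 <= n < N.+1) p n = 1.
Local Notation OC := (g_sigma_algebraType C).

Let ev (n : nat) : set Omega := J @^-1` [set n].

Lemma measurable_index_event n : measurable (ev n).
Proof. by rewrite -[ev n]setTI; exact: measurable_funPT. Qed.

Let integrable_indic_event (A : set Omega) : measurable A ->
  P.-integrable setT (EFin \o (\1_A : Omega -> R)).
Proof.
move=> mA; apply: integrable_bounded_fun; first exact: measurable_indic.
by exists 1 => w; rewrite indicE; case: (_ \in _); rewrite ?normr1 ?normr0.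
Qed.

Lemma Rintegral_index_event n : (n <= N)%N -> \int[P]_w \1_(ev n) w = p n.
Proof.
move=> nN; rewrite /Rintegral integral_indic//; last exact: measurable_index_event.
by rewrite setIT; exact: (congr1 fine (pJ nN)).
Qed.

(** Independence says that [1_(J = n) - p n] has zero integral over each event
    of the sigma-algebra. *)
Lemma Rintegral_index_mul n (f : Omega -> R) : (n <= N)%N ->
  measurable_fun (T := OC) setT f -> bounded_by_cst f ->
  \int[P]_w (f w * \1_(ev n) w) = p n * \int[P]_w f w.
Proof.
move=> nN mf bf.
have mf' := measurable_fun_sub_sigma subC mf.
have mev := measurable_index_event n.
have Iev := integrable_indic_event mev.
have Icst := integrable_cst_fun P (p n).
have ID : P.-integrable setT (EFin \o (fun w => \1_(ev n) w - p n)).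
  by have := integrableB measurableT Iev Icst.
have If := integrable_bounded_fun P mf' bf.
rewrite -RintegralZl//; apply/eqP; rewrite -subr_eq0 -RintegralB//; last 2 first.
- exact: integrable_bounded_mul.
- by have := integrableZl measurableT (p n) If.
under eq_Rintegral do rewrite [p n * _]mulrC -mulrBr.
apply/eqP; apply: (Rintegral_bounded_mul_eq0 subC) => //.
move=> A CA; have mA := subC CA.
rewrite RintegralB//; try by apply: integrableS measurableT mA _ _.
have EA : P (ev n `&` A) = ((p n)%:E * P A)%E by rewrite /ev indepJ// pJ.
rewrite Rintegral_cst// /Rintegral integral_indic// [X in fine X - _]EA.
by rewrite fineM ?fin_num_measure// subrr.
Qed.

(** The weights [p n] sum to one, so almost surely [J <= N], and [f_J] is
    the sum of the [f_n 1_(J = n)] over [n <= N]; independence gives the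
    expectation of each term. *)
Lemma expectation_random_index (f : nat -> Omega -> R) (B : R) :
  (forall n w, 0 <= f n w <= B) ->
  (forall n, measurable_fun (T := OC) setT (f n)) ->
  (\int[P]_w (f (J w) w)%:E <=
   (\sum_(0 <= n < N.+1) p n * \int[P]_w f n w)%:E)%E.
Proof.
move=> f0B mf.
have B0 : 0 <= B by have /andP[/le_trans] := f0B 0%N point; apply.
have bf n : bounded_by_cst (f n).
  by exists B => w; have /andP[f0 fB] := f0B n w; rewrite ger0_norm.
have mf' n := measurable_fun_sub_sigma subC (mf n).
have mfJ : measurable_fun setT (fun w => f (J w) w).
  move=> _ U mU; rewrite setTI.
  have -> : (fun w => f (J w) w) @^-1` U = \bigcup_n (ev n `&` f n @^-1` U).
    apply/seteqP; split => w /=; first by exists (J w).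
    by move=> [n _ [/= <-]].
  apply: bigcupT_measurable => n; apply: measurableI.
    exact: measurable_index_event.
  by rewrite -[X in measurable X]setTI; exact: mf'.
have IfJ : P.-integrable setT (EFin \o (fun w => f (J w) w)).
  apply: integrable_bounded_fun => //; exists B => w.
  by have /andP[f0 fB] := f0B (J w) w; rewrite ger0_norm.
have Iev n := integrable_indic_event (measurable_index_event n).
have Ifev n : P.-integrable setT (EFin \o (fun w => f n w * \1_(ev n) w)).
  exact: integrable_bounded_mul.
have Isev := integrable_sum_fun (index_iota 0 N.+1) Iev.
have Isfev := integrable_sum_fun (index_iota 0 N.+1) Ifev.
(* the indicator of [J > N], an event of probability zero *)
pose rest w : R := 1 - \sum_(0 <= n < N.+1) \1_(ev n) w.
have Irest : P.-integrable setT (EFin \o rest).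
  by have := integrableB measurableT (integrable_cst_fun P 1) Isev.
have IBrest : P.-integrable setT (EFin \o (fun w => B * rest w)).
  by have := integrableZl measurableT B Irest.
have rest0 : \int[P]_w rest w = 0.
  rewrite RintegralB//; last exact: integrable_cst_fun.
  rewrite Rintegral_setT_cst Rintegral_sum// -sum_p.
  rewrite -sumrB big_nat big1// => n /andP[_ nN].
  by rewrite Rintegral_index_event// subrr.
have evE n w : \1_(ev n) w = (J w == n)%:R :> R.
  by rewrite indicE; congr ((nat_of_bool _)%:R); apply/idP/eqP; rewrite inE.
rewrite -EFin_Rintegral// lee_fin.
rewrite (_ : \sum_(_ <= _ < _) _ =
    \int[P]_w (\sum_(0 <= n < N.+1) f n w * \1_(ev n) w + B * rest w)).
  apply: le_Rintegral => //; first by have := integrableD measurableT Isfev IBrest.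
  move=> w _; rewrite /rest.
  under eq_bigr do rewrite evE.
  under [X in 1 - X]eq_bigr do rewrite evE -[_%:R]mul1r.
  rewrite !sum_nat_delta; case: ifP => _; first by rewrite subrr mulr0 addr0.
  by rewrite subr0 mulr1 add0r; have /andP[] := f0B (J w) w.
rewrite RintegralD// RintegralZl// rest0 mulr0 addr0 Rintegral_sum//.
rewrite !big_nat; apply: eq_bigr => n /andP[_ nN].
by rewrite Rintegral_index_mul.
Qed.

End IndependentIndex.

(** * Convergence of the recursion *)

Unset Implicit Arguments.
Set Strict Implicit.

Theorem theorem3p1 (R : realType) (d q : nat) (hd : (0 < d)%N)
  (dS : measure_display) (S : measurableType dS) (hS : is_subspace_of_Rn R q S)
  (dO : measure_display) (Omega : measurableType dO) (P : probability Omega R)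
  (V : 'cV[R]_d -> R) (thetastar : 'cV[R]_d)
  (hmin : forall t, V thetastar <= V t)
  (H : 'cV[R]_d -> S -> 'cV[R]_d)
  (hH : forall t i, measurable_fun setT (fun x => H t x i 0 : R))
  (Pk : 'cV[R]_d -> R.-pker S ~> S) (pi : 'cV[R]_d -> probability S R)
  (hpi : forall t, invariant_law (Pk t) (pi t))
  (hgrad : forall t, mean_field H pi t = grad V t)
  (gamma T : nat -> R)
  (hgamma : forall n, (1 <= n)%N -> 0 < gamma n)
  (hT : forall n, (1 <= n)%N -> 0 < T n)
  (K : nat -> {RV P >-> nat}) (X : nat -> nat -> {RV P >-> S})
  (A : nat -> Omega -> 'M[R]_d)
  (theta0 : 'cV[R]_d) (theta : nat -> Omega -> 'cV[R]_d)
  (hsample : mlmc_sampling P Pk K X theta)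
  (hrec : mlmc_recursion H gamma T A K X theta0 theta)
  (L : R)
  (hVdiff : forall t, differentiable V t)
  (hVlip : forall t t', enorm (grad V t - grad V t') <= L * enorm (t - t'))
  (G : R) (hG : 0 < G)
  (hHG : forall t, (sup_enorm (H t) <= G%:E)%E)
  (c1 c2 : R)
  (hbias : forall n, exists2 Y : Omega -> 'cV[R]_d,
     is_cond_exp_vec P (mlmc_filtration K X n) (mlmc_hatH H T K X theta n) Y &
     {ae P, forall w,
       enorm (Y w - mean_field H pi (theta n w)) <= c1 * G / T n.+1})
  (hvar : forall n,
     ('E_P[fun w => (enorm (mlmc_hatH H T K X theta n w) ^+ 2)%R]
      <= (c2 * G ^+ 2 * ln (T n.+1))%:E)%E)
  (hAmeas : forall n, mx_measurable_wrt (mlmc_filtration K X n) (A n))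
  (hApos : forall n w, sym_posdef (A n w))
  (lo hi : nat -> R)
  (hlohi : forall n, 0 < lo n.+1 /\ lo n.+1 <= hi n.+1)
  (hlambda : forall n w,
     lo n.+1 <= lambda_min (A n w) /\ lambda_max (A n w) <= hi n.+1)
  (N : nat) (hN : (1 <= N)%N)
  (varpi : R) (hvarpi : varpi = \sum_(0 <= k < N.+1) gamma k.+1 * lo k.+1)
  (J : {RV P >-> nat}) (hJind : indep_of P J (mlmc_sigma K X))
  (hJ : forall n, (n <= N)%N ->
     P (J @^-1` [set n]) = (gamma n.+1 * lo n.+1 / varpi)%:E) :
  ('E_P[fun w => (enorm (grad V (theta (J w) w)) ^+ 2)%R] <=
   (2 / varpi)%:E *
   ('E_P[V \o theta 0%N] - (V thetastar)%:E
    + (c1 * G ^+ 2 * \sum_(1 <= n < N.+2) gamma n * (hi n / T n))%:E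
    + (c2 * G ^+ 2 * (L / 2) *
       \sum_(1 <= n < N.+2) gamma n ^+ 2 * hi n ^+ 2 * ln (T n))%:E))%E.
Proof.
have G0 := ltW hG.
have L0 : 0 <= L.
  (* in positive dimension a Lipschitz constant cannot be negative *)
  pose e : 'cV[R]_d := delta_mx (Ordinal hd) 0.
  have e0 : 0 < enorm e.
    rewrite lt0r enorm_ge0 andbT; apply/eqP => /enorm_eq0/matrixP/(_ (Ordinal hd) 0).
    by rewrite !mxE !eqxx => /eqP; rewrite oner_eq0.
  have := le_trans (enorm_ge0 _) (hVlip e 0).
  by rewrite subr0 pmulr_lge0.
have HG t x : enorm (H t x) <= G := enorm_le_sup_enorm (hHG t) x.
have gradG t : enorm (grad V t) <= G.
  rewrite -hgrad; apply: enorm_Rintegral_le => //; exact: HG.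
have [th0 thS mth] := hrec.
have lo0 n : 0 < lo n.+1 by have [] := hlohi n.
have hi0 n : 0 < hi n.+1 by have [l0 lh] := hlohi n; exact: lt_le_trans l0 lh.
have symA n w : (A n w)^T = A n w by have [] := hApos n w.
have loA n w x : lo n.+1 * dotv x x <= dotv x (A n w *m x).
  have [lA _] := hlambda n w.
  by rewrite (le_trans _ (lambda_min_rayleigh x hd (symA n w)))// ler_wpM2r// dotvv_ge0.
have hiA n w x : dotv x (A n w *m x) <= hi n.+1 * dotv x x.
  have [_ Ah] := hlambda n w.
  by rewrite (le_trans (lambda_max_rayleigh x hd (symA n w)))// ler_wpM2r// dotvv_ge0.
pose g n := mlmc_hatH H T K X theta n.
pose B n := G + T n.+1 * (G + G).
have gB n w : enorm (g n w) <= B n.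
  by apply: enorm_mlmc_estimator_le => //; exact/ltW/hT.
have bth n : exists M, forall w, enorm (theta n w) <= M.
  elim: n => [|n [M thM]]; first by exists (enorm theta0) => w; rewrite th0.
  exists (M + gamma n.+1 * (hi n.+1 * B n)) => w.
  rewrite thS (le_trans (enormB _ _))// lerD// enormZ gtr0_norm ?hgamma//.
  rewrite ler_wpM2l ?(ltW (hgamma _ _))//.
  have AgB := enorm_precond_le (symA n) (loA n) (hiA n) (lo0 n) (ltW (hi0 n)) w (g n w).
  by rewrite (le_trans AgB)// ler_wpM2l ?(ltW (hi0 n)).
have mK n : measurable_fun setT (K n) by [].
have mX m i : measurable_fun setT (X m i) by [].
have subC n : <<s mlmc_past K X n>> `<=` measurable :=
  mlmc_filtration_measurable mK mX (n:=n).
have mth' n i : measurable_fun (T := g_sigma_algebraType (mlmc_past K X n)) setT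
    (fun w => theta n w i 0).
  by apply/measurable_wrtE; exact: mth.
have mA' n i j : measurable_fun (T := g_sigma_algebraType (mlmc_past K X n)) setT
    (fun w => A n w i j).
  by apply/measurable_wrtE; exact: hAmeas.
pose sq n := \int[P]_w (enorm (grad V (theta n w)) ^+ 2).
pose a n := \int[P]_w V (theta n w).
(* error of the step of index [n], from the bias and from the second moment *)
pose e n := c1 * G ^+ 2 * (gamma n * (hi n / T n)) +
            c2 * G ^+ 2 * (L / 2) * (gamma n ^+ 2 * hi n ^+ 2 * ln (T n)).
have step n : gamma n.+1 * lo n.+1 * sq n <= a n - a n.+1 + e n.+1.
  have [M thM] := bth n; have [Y gY bY] := hbias n.
  have v2 : \int[P]_w (enorm (g n w) ^+ 2) <= c2 * G ^+ 2 * ln (T n.+1).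
    have := hvar n; rewrite unlock => v2.
    rewrite -lee_fin fineK// ge0_fin_numE; first exact: le_lt_trans v2 (ltry _).
    by apply: integral_ge0 => w _; rewrite lee_fin sqr_ge0.
  have bY' : {ae P, forall w, enorm (Y w - grad V (theta n w)) <= c1 * G / T n.+1}.
    by apply: filterS bY => w; rewrite hgrad.
  have := expected_descent_step (subC n) hVdiff hmin L0 hVlip (mth' n) (mA' n) thM
    (fun w => gradG _) (gB n) (symA n) (loA n) (hiA n) (lo0 n) (ltW (hi0 n))
    (ltW (hgamma n.+1 isT)) gY bY' v2.
  have -> : \int[P]_w V (theta n w - gamma n.+1 *: (A n w *m g n w)) = a n.+1.
    by apply: eq_Rintegral => w _; rewrite thS.
  move=> /le_trans; apply; rewrite -addrA lerD2l /e.
  rewrite le_eqVlt; apply/orP; left; apply/eqP; field; exact: lt0r_neq0 (hT n.+1 isT).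
have sum_step m : \sum_(0 <= n < m) gamma n.+1 * lo n.+1 * sq n <=
    a 0%N - a m + \sum_(0 <= n < m) e n.+1.
  elim: m => [|m IH]; first by rewrite !big_nil subrr addr0.
  by rewrite !big_nat_recr//=; have := step m; lra.
have a0 : a 0%N = V theta0.
  by rewrite /a; under eq_Rintegral do rewrite th0; rewrite Rintegral_setT_cst.
have IVth n : P.-integrable setT (EFin \o (V \o theta n)).
  have [M thM] := bth n.
  apply: (integrable_objective P hVdiff hmin L0 hVlip _ thM) => i.
  exact: (measurable_fun_sub_sigma (subC n) (mth' n i)).
have aN : V thetastar <= a N.+1.
  rewrite -[leLHS](Rintegral_setT_cst P); apply: le_Rintegral => //.
  exact: integrable_cst_fun.
  exact: IVth.
pose rhs := V theta0 - V thetastar + \sum_(0 <= n < N.+1) e n.+1.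
have sum_q : \sum_(0 <= n < N.+1) gamma n.+1 * lo n.+1 * sq n <= rhs.
  by have := sum_step N.+1; rewrite a0 /rhs; lra.
have varpi0 : 0 < varpi.
  rewrite hvarpi big_nat_recr//= ltr_wpDl ?mulr_gt0 ?hgamma//.
  by apply: sumr_ge0 => n _; rewrite mulr_ge0 ?ltW ?hgamma.
have sum_p : \sum_(0 <= n < N.+1) gamma n.+1 * lo n.+1 / varpi = 1.
  by rewrite -mulr_suml -hvarpi divff// gt_eqF.
have sq0 n : 0 <= sq n by apply: Rintegral_ge0 => w _; exact: sqr_ge0.
(* this is what allows the factor 2 at the end *)
have rhs0 : 0 <= rhs.
  rewrite (le_trans _ sum_q)//; apply: sumr_ge0 => n _.
  by rewrite mulr_ge0 ?sq0// ltW// mulr_gt0 ?hgamma.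
have indexed : ('E_P[fun w => (enorm (grad V (theta (J w) w)) ^+ 2)%R] <=
    (\sum_(0 <= n < N.+1) gamma n.+1 * lo n.+1 / varpi * sq n)%:E)%E.
  rewrite unlock.
  apply: (@expectation_random_index _ _ _ P (\bigcup_n mlmc_filtration K X n)
    (mlmc_sigma_measurable mK mX) J hJind N
    (fun n => gamma n.+1 * lo n.+1 / varpi) hJ sum_p
    (fun n w => enorm (grad V (theta n w)) ^+ 2) (G ^+ 2)).
    by move=> n w; rewrite sqr_ge0 lerXn2r ?nnegrE ?enorm_ge0.
  move=> n; have := measurable_sq_grad hVlip (mth' n).
  move=> mq; apply/measurable_wrtE.
  apply: subset_trans (mlmc_filtration_sub_sigma (n:=n)).
  exact/measurable_wrtE.
apply: (le_trans indexed).
have -> : ('E_P[V \o theta 0%N] = (V theta0)%:E)%E.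
  by rewrite unlock -a0 -EFin_Rintegral.
rewrite -EFinB -!EFinD -EFinM lee_fin.
rewrite (_ : _ + _ + _ = rhs); last first.
  rewrite /rhs !big_add1/= -addrA; congr (_ + _).
  by rewrite !mulr_sumr -big_split.
rewrite (@le_trans _ _ (varpi^-1 * rhs))//.
  apply: le_trans (ler_wpM2l _ sum_q); last by rewrite invr_ge0 ltW.
  by rewrite mulr_sumr ler_sum// => n _; rewrite mulrAC mulrC.
by rewrite ler_wpM2r// ler_peMl ?ler1n// invr_ge0 ltW.
Qed.
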